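(* Both $\omega(S_n)$ and $\omega(A_n)$ are at least $(1-o(1))n$ as $n\to\infty$; that is, for every $\delta>0$ there exists $n_0$ such that for all integers $n\geq n_0$ one has $\omega(S_n)\geq (1-\delta)n$ and $\omega(A_n)\geq(1-\delta)n$.
   Context: $S_n$ and $A_n$ denote the symmetric and alternating groups of degree $n$. For a finite group $G$ that can be generated by $2$ elements, $\omega(G)$ is the maximal size of a subset $S \subseteq G$ such that $\langle x,y\rangle = G$ for all $x,y\in S$ with $x\neq y$. *)

(* Defs.v *)
From mathcomp Require Import all_boot all_order all_algebra all_fingroup all_solvable.
From mathcomp Require Import reals.

Set Implicit Arguments.
Unset Strict Implicit.
Unset Printing Implicit Defensive.

Import GroupScope.

Definition pairwise_generating (gT : finGroupType) (G S : {set gT}) : bool :=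
  (S \subset G) &&
  [forall x in S, forall y in S, (x != y) ==> (<<[set x; y]>> == G)].

(* The singletons of G are vacuously pairwise generating, so this is a maximum
   over a nonempty family whenever G is a group; the definition is only of
   interest when G can be generated by two elements, as are all symmetric and
   alternating groups. *)
Definition omega (gT : finGroupType) (G : {set gT}) : nat :=
  \max_(S : {set gT} | pairwise_generating G S) #|S|.

(* Main.v *)
(** Fix a point [a].  A "spider" with body [E] is a permutation [x] without
    fixed points consisting of a 3-cycle through [a] and some 2-cycles, all
    inside [a |: E], and of one long cycle on the complement, of length prime
    to 3; so some power of [x] is the 3-cycle [(a, x a, x (x a))].

    Let [x] and [y] be spiders whose bodies share at most one point.  The
    relation "[u = v] or some 3-cycle of [<<x, y>>] maps [u] to [v]" is an
    invariant equivalence relation, and the class of [a] is stable under both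
    [x] and [y] because [x a] and [y a] belong to it.  Since neither [x] nor [y]
    has a fixed point and the bodies hardly meet, [<<x, y>>] is transitive, so
    there is a single class, and then [<<x, y>>] contains every 3-cycle.

    The number [k <= 3] of 2-cycles can be chosen so that the long cycle has
    length prime to 3 and the spider has any prescribed parity.  As bodies, the
    translates of a Golomb ruler of length 34 give [n - O(1)] sets meeting
    pairwise in at most one point; odd spiders serve for the symmetric group
    and even ones for the alternating group. *)

Require Import Defs.
From mathcomp Require Import all_boot all_order all_algebra all_fingroup all_solvable.
From mathcomp Require Import reals.
From mathcomp Require Import zify lra.

Set Implicit Arguments.
Unset Strict Implicit.
Unset Printing Implicit Defensive.

Import Order.TTheory GRing.Theory Num.Theory.

(** * Cycles as products of transpositions *)

Section Cycles.
Import GroupScope.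
Context {T : finType}.
Implicit Types (x y z a b c : T) (s : seq T) (K : {set T}) (p q : {perm T}).

(** By finiteness [p] maps [K] onto itself, so injectivity keeps outside points outside. *)
Lemma stable_setC p K : {in K, forall z, p z \in K} ->
  {in ~: K, forall z, p z \in ~: K}.
Proof.
move=> sK z; rewrite !inE; apply: contra => pzK.
have sub : p @: K \subset K by apply/subsetP => _ /imsetP[y yK ->]; apply: sK.
have /eqP eK : p @: K == K.
  by rewrite eqEcard sub card_imset ?leqnn //=; apply: perm_inj.
by move: pzK; rewrite -{1}eK => /imsetP[y yK /perm_inj ->].
Qed.

(* The cycle (z_1 ... z_k) for s = [:: z_1; ...; z_k]. *)
Definition cyc s : {perm T} :=
  if s is r :: ys then \prod_(y <- ys) tperm r y else 1.

Lemma cyc_out s z : z \notin s -> cyc s z = z.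
Proof.
case: s => [|r ys]; first by rewrite perm1.
rewrite inE negb_or /= => /andP[zr].
elim: ys => [|y ys IH]; first by rewrite big_nil perm1.
rewrite inE negb_or => /andP[zy zys].
by rewrite big_cons permM tpermD 1?eq_sym // IH.
Qed.

Lemma cyc_in s z : z \in s -> cyc s z \in s.
Proof.
apply: contraTT => zs.
have : {in ~: [set w in s], forall w, cyc s w \in ~: [set w in s]}.
  by move=> w; rewrite !inE => ws; rewrite cyc_out.
move/stable_setC => /(_ z); rewrite setCK !inE => H.
by apply/negP => /H; rewrite (negPf zs).
Qed.

Lemma cyc_trans s K z : uniq s -> {in s, forall w, w \in K -> cyc s w \in K} ->
  z \in s -> z \in K -> {subset s <= K}.
Proof.
wlog: z s K / z = head z s => [IH|zs].
  case: s => [|r ys] us sK zs zK; first by [].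
  apply: (IH r (r :: ys) K) => //; first exact: mem_head.
  (* If the head [r] were outside [K], the case of the head applied to [~: K] would put [z] outside
     [K] too. *)
  apply: contraLR zK => rK; rewrite -in_setC.
  have rC : r \in ~: K by rewrite inE.
  have sC : {in r :: ys, forall w, w \in ~: K -> cyc (r :: ys) w \in ~: K}.
    move=> w ws wK.
    have : {in K :&: [set u in r :: ys], forall u,
        cyc (r :: ys) u \in K :&: [set u in r :: ys]}.
      by move=> u; rewrite !in_setI !in_set => /andP[uK us']; rewrite sK ?cyc_in.
    move/stable_setC => /(_ w); rewrite !in_setC !in_setI !in_set ws.
    by rewrite (cyc_in ws) !andbT; apply; rewrite -in_setC.
  exact: (IH r (r :: ys) (~: K) erefl us sC (mem_head _ _) rC z zs).
case: s zs => [|r ys] // -> us sK _; rewrite [head _ _]/= => rK.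
(* Deleting [y] leaves a cycle that sends [r] where the longer one sends [y] and agrees with it on
   [ys]. *)
elim: ys us sK => [|y ys IH] us sK w; first by rewrite inE => /eqP ->.
move: us; rewrite /= inE negb_or => /and3P[/andP[ry rys] yys uys].
have yK : y \in K.
  have := sK r (mem_head _ _) rK; rewrite /= big_cons permM tpermL.
  by have := @cyc_out (r :: ys) y; rewrite inE eq_sym negb_or ry yys /= => ->.
have sub : {subset r :: ys <= K}.
  apply: IH; first by rewrite /= rys.
  move=> u us uK; have [->|ur] := eqVneq u r.
    have := sK y; rewrite /= big_cons permM tpermR; apply=> //.
    by rewrite !inE eqxx orbT.
  have uy : u != y.
    by apply: contraNneq yys => <-; move: us; rewrite inE (negPf ur).
  have := sK u; rewrite /= big_cons permM tpermD 1?eq_sym //; apply=> //.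
  by move: us; rewrite !inE => /orP[->|->]; rewrite ?orbT.
rewrite !inE => /or3P[/eqP ->|/eqP ->|wys] //.
by apply: sub; rewrite inE wys orbT.
Qed.

Lemma cyc_exp s : uniq s -> cyc s ^+ size s = 1.
Proof.
move=> us; apply/permP => z; rewrite perm1.
have [zs|zs] := boolP (z \in s); last by rewrite permX_fix // cyc_out.
have eo : porbit (cyc s) z =i s.
  move=> w; apply/idP/idP; last first.
    apply: (@cyc_trans s (porbit (cyc s) z) z) => //; last exact: porbit_id.
    by move=> u _; rewrite -!eq_porbit_mem => /eqP <-; rewrite (porbit_perm _ 1).
  case/porbitP => i ->; elim: i => [|i IH]; first by rewrite perm1.
  by rewrite expgSr permM cyc_in.
by have := iter_porbit (cyc s) z; rewrite (eq_card eo) (card_uniqP us) permX.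
Qed.

Lemma odd_cyc s : uniq s -> odd_perm (cyc s) = odd (size s).-1.
Proof.
case: s => [|r ys] /=; first by rewrite odd_perm1.
elim: ys => [|y ys IH] /=; first by rewrite big_nil odd_perm1.
rewrite inE negb_or -andbA => /and4P[ry rys yys uys].
by rewrite big_cons odd_permM odd_tperm ry IH // rys.
Qed.

End Cycles.

(** * Groups containing 3-cycles, and generation by two spiders *)

Section ThreeCycles.
Import GroupScope.
Context {T : finType}.
Implicit Types (x y p : {perm T}) (a b c d : T) (K E F : {set T}).
Implicit Types (H : {group {perm T}}).

(* The 3-cycle [(a b c)] when the three points are distinct. *)
Definition tri a b c : {perm T} := tperm a b * tperm a c.

Lemma triJ a b c p : tri a b c ^ p = tri (p a) (p b) (p c).
Proof. by rewrite conjMg !tpermJ. Qed.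

Lemma triV a b c : (tri a b c)^-1 = tri a c b.
Proof. by rewrite invMg !tpermV. Qed.

Lemma triE a b c : uniq [:: a; b; c] ->
  [/\ tri a b c a = b, tri a b c b = c & tri a b c c = a].
Proof.
rewrite /= !inE negb_or andbT => /andP[/andP[ab ac] bc]; rewrite !permM.
by split; [rewrite tpermL tpermD // eq_sym | rewrite tpermR tpermL |
  rewrite [tperm a b c]tpermD // tpermR].
Qed.

Lemma triD a b c d : d != a -> d != b -> d != c -> tri a b c d = d.
Proof. by move=> da db dc; rewrite permM !tpermD // eq_sym. Qed.

Lemma tri_rot a b c : uniq [:: a; b; c] -> tri a b c = tri b c a.
Proof.
move=> u; have u' : uniq [:: b; c; a] by rewrite -(rot_uniq 1) in u.
have [ea eb ec] := triE u; have [fb fc fa] := triE u'.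
apply/permP => z.
have [->|za] := eqVneq z a; first by rewrite ea fa.
have [->|zb] := eqVneq z b; first by rewrite eb fb.
have [->|zc] := eqVneq z c; first by rewrite ec fc.
by rewrite !triD.
Qed.

Definition link H a b :=
  (a == b) || [exists c, uniq [:: a; b; c] && (tri a b c \in H)].

Lemma linkI H a b c : uniq [:: a; b; c] -> tri a b c \in H -> link H a b.
Proof. by move=> u t; apply/orP; right; apply/existsP; exists c; rewrite u. Qed.

Lemma link_sym H a b : link H a b -> link H b a.
Proof.
case/orP=> [/eqP ->|/existsP[c /andP[u t]]]; first by rewrite /link eqxx.
apply: (@linkI _ _ _ c); last by rewrite -triV groupV -tri_rot.
by move: u; rewrite /= !inE (eq_sym b a) !negb_or => /andP[/andP[-> ->] ->].
Qed.

Lemma link_conj H p a b : p \in H -> link H a b -> link H (p a) (p b).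
Proof.
move=> pH /orP[/eqP ->|/existsP[c /andP[u t]]]; first by rewrite /link eqxx.
apply: (@linkI _ _ _ (p c)); last by rewrite -triJ groupJ.
rewrite -[X in uniq X]/(map p [:: a; b; c]) map_inj_uniq //.
exact: perm_inj.
Qed.

(** Conjugation by a 3-cycle [(b d e)] of [H] turns a link from [a] to [b] into one from [a] to [d],
    provided [a] is fixed; the cases where [a] is [b], [d] or [e] are direct. *)
Lemma link_trans H a b d : link H a b -> link H b d -> link H a d.
Proof.
move=> ab /orP[/eqP <- //|/existsP[e /andP[u t]]].
have [->|ad] := eqVneq a d; first by rewrite /link eqxx.
have [<-|ba] := eqVneq b a; first exact: linkI u t.
have [ub _ _] := triE u.
have [ae|ae] := eqVneq a e.
  have u' : uniq [:: a; b; d] by rewrite ae -(rot_uniq 1).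
  apply: (@linkI _ _ _ b); last by rewrite -triV groupV tri_rot // ae.
  by move: u'; rewrite /= !inE !negb_or (eq_sym d b) !andbT => /andP[/andP[-> ->] ->].
have := link_conj t ab.
by rewrite ub triD // eq_sym.
Qed.

(** Take [(a b x)] and [(x c y)] in [H]. Conjugating the first by the second gives [(a b c)] unless
    [y] is [a] or [b]; in those cases conjugating by the inverse of the second gives the inverse of
    [(a b c)]. *)
Lemma tri_linked H : (forall a b, link H a b) ->
  forall a b c, uniq [:: a; b; c] -> tri a b c \in H.
Proof.
move=> lk a b c u; move: (u); rewrite /= !inE negb_or andbT.
move=> /andP[/andP[ab ac] bc].
case/orP: (lk a b) => [|/existsP[x /andP[ux tx]]]; first by rewrite (negPf ab).
case/orP: (lk x c) => [/eqP <- //|/existsP[y /andP[uy ty]]].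
have [ex ec ey] := triE uy.
move: (ux); rewrite /= !inE negb_or andbT => /andP[/andP[_ ax] bx].
have [vx vc vy] : [/\ (tri x c y)^-1 x = y, (tri x c y)^-1 c = x &
    (tri x c y)^-1 y = c] by split; apply: (canLR (permK _)).
have txV := groupJ tx (groupVr ty).
have fixV z : z != x -> z != c -> z != y -> (tri x c y)^-1 z = z.
  by move=> zx zc zy; apply: (canLR (permK _)); rewrite triD.
have [ya|ya] := eqVneq y a.
  move: txV; rewrite triJ -{1}ya vy vx fixV // ya 1?eq_sym //.
  by rewrite -groupV triV tri_rot // -(rot_uniq 1).
have [yb|yb] := eqVneq y b.
  move: txV; rewrite triJ -{1}yb vy vx fixV // yb //.
  by rewrite -groupV triV.
by have := groupJ tx ty; rewrite triJ ex !triD // eq_sym.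
Qed.

Lemma Alt_linked H : (forall a b, link H a b) -> 'Alt_T \subset H.
Proof.
move=> /tri_linked tH.
have tH' a b c : a != b -> a != c -> tri a b c \in H.
  move=> ab ac; have [<-|bc] := eqVneq b c; first by rewrite /tri tperm2 group1.
  by apply: tH; rewrite /= !inE negb_or ab ac bc.
have tt a b c d : a != b -> c != d -> tperm a b * tperm c d \in H.
  move=> ab cd; have [eac|ac] := eqVneq a c.
    by rewrite -eac; apply: tH' => //; rewrite eac.
  have -> : tperm a b * tperm c d = tri a b c * tri c a d.
    by rewrite /tri (tpermC c a) mulgA -(mulgA (tperm a b)) tperm2 mulg1.
  by rewrite groupM // tH' // eq_sym.
(* An even permutation is a product of an even number of transpositions, consumed here two at a
   time. *)
apply/subsetP => s; rewrite Alt_even; have [ts -> dts] := prod_tpermP s.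
rewrite odd_perm_prod // => /negbTE ets.
have [n] := ubnP (size ts); elim: n ts dts ets => // n IH [|t [|u ts]] //=.
  by rewrite big_nil group1.
move=> /and3P[dt du dts] ets sz; rewrite !big_cons mulgA groupM ?tt //.
apply: IH => //; [by rewrite negbK in ets|lia].
Qed.

(* The fourth condition says that [x] is transitive on the complement of [a |: E]. *)
Definition spider a E x :=
  [/\ a \notin E, {in a |: E, forall z, x z \in a |: E}, forall z, x z != z,
      forall K z, {in K, forall w, x w \in K} -> z \notin a |: E -> z \in K ->
        ~: (a |: E) \subset K &
      exists e, uniq [:: a; x a; x (x a)] /\ x ^+ e = tri a (x a) (x (x a))].

Lemma spider_legs a E x : spider a E x ->
  [/\ x a \in E, x (x a) \in E & uniq [:: a; x a; x (x a)]].
Proof.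
case=> _ st _ _ [e [u _]]; move: (u).
rewrite /= !inE negb_or andbT => /andP[/andP[ab ac] bc].
have := st _ (setU11 a E); rewrite inE [x a \in [set a]]inE eq_sym (negPf ab) /= => b.
by have := st _ (setU1r a b); rewrite inE [_ \in [set a]]inE eq_sym (negPf ac).
Qed.

Lemma card_le1_eq E u v : #|E| <= 1 -> u \in E -> v \in E -> u = v.
Proof. by move=> /card_le1_eqP h uE vE; apply: h. Qed.

Lemma spider_neq a E F x y : spider a E x -> spider a F y ->
  #|E :&: F| <= 1 -> x != y.
Proof.
move=> sx sy le1; apply/negP => /eqP exy; rewrite -exy in sy.
have [b c] := spider_legs sx; have [b' c' _] := spider_legs sy.
rewrite /= !inE => /andP[_ /andP[/eqP bc _]]; apply: bc.
by apply: (card_le1_eq le1); rewrite inE ?b ?c.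
Qed.

(** The points [x a] and [x (x a)] are distinct and lie in [E], so one of them is outside [F], where
    [y] acts transitively. *)
Lemma spider_cover a E F x y K : spider a E x -> spider a F y ->
  #|E :&: F| <= 1 -> {in K, forall w, x w \in K} -> {in K, forall w, y w \in K} ->
  a \in K -> ~: (a |: F) \subset K.
Proof.
move=> sx [_ _ _ cy _] le1 stx sty aK.
have [b c] := spider_legs sx.
rewrite /= !inE negb_or andbT => /andP[/andP[ab ac] bc].
have [bF|bF] := boolP (x a \in F); last first.
  by apply: (cy _ (x a)) => //; [rewrite !inE negb_or eq_sym ab|exact: stx aK].
apply: (cy _ (x (x a))) => //; last exact: stx (stx _ aK).
rewrite !inE negb_or eq_sym ac; apply/negP => cF; case/eqP: bc.
by apply: (card_le1_eq le1); rewrite inE ?b ?c.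
Qed.

Lemma spider_gen a E F x y : spider a E x -> spider a F y ->
  #|E :&: F| <= 1 -> 'Alt_T \subset <<[set x; y]>>.
Proof.
move=> sx sy le1; set H := <<[set x; y]>>%G.
have xH : x \in H by rewrite mem_gen // !inE eqxx.
have yH : y \in H by rewrite mem_gen // !inE eqxx orbT.
pose K := [set z | link H a z].
have stable E' p : spider a E' p -> p \in H -> {in K, forall z, p z \in K}.
  move=> [_ _ _ _ [e [u pe]]] pH z; rewrite !inE => az.
  apply: link_trans (link_conj pH az).
  by apply: (@linkI _ _ _ (p (p a))) => //; rewrite -pe groupX.
have stx := stable _ _ sx xH; have sty := stable _ _ sy yH.
have aK : a \in K by rewrite inE /link eqxx.
have cF : ~: (a |: F) \subset K := spider_cover sx sy le1 stx sty aK.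
have cE : ~: (a |: E) \subset K by apply: spider_cover sy sx _ sty stx aK; rewrite setIC.
have all z : z \in K.
  have [->//|za] := eqVneq z a.
  have [zE|zE] := boolP (z \in E); last first.
    by apply: (subsetP cE); rewrite !inE negb_or za.
  have [zF|zF] := boolP (z \in F); last first.
    by apply: (subsetP cF); rewrite !inE negb_or za.
  have [_ st fixfree _ _] := sx.
  (* Here [z] is the only common point of the bodies, so [x z], being different from [z], is [a] or
     lies outside [F]; stability of [~: K] then brings [z] into [K]. *)
  have xzK : x z \in K.
    have [->//|xza] := eqVneq (x z) a.
    have xzE : x z \in E.
      by have := st z (setU1r a zE); rewrite in_setU1 (negPf xza).
    apply: (subsetP cF); rewrite !inE negb_or xza /=; apply/negP => xzF.
    case/eqP: (fixfree z).
    by apply: (card_le1_eq le1); rewrite inE ?zE ?xzE.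
  apply: contraLR xzK => zK; rewrite -in_setC (stable_setC stx) //.
  by rewrite inE.
apply: Alt_linked => u v.
have := all u; have := all v; rewrite !inE => av /link_sym au.
exact: link_trans au av.
Qed.

End ThreeCycles.

(** * Construction of spiders from disjoint cycles *)

Section Spiders.
Import GroupScope.
Context {T : finType}.
Implicit Types (x y p : {perm T}) (a b c d z : T) (s : seq T) (K E : {set T}).

Lemma cyc_fixfree s z : uniq s -> 1 < size s -> z \in s -> cyc s z != z.
Proof.
move=> us s1 zs; apply: contraTneq s1 => ez; rewrite -leqNgt.
have sub : {subset s <= [set z]}.
  apply: (cyc_trans us _ zs); rewrite ?set11 // => w _.
  by rewrite !inE => /eqP ->; rewrite ez.
rewrite -(card_uniqP us) -(cards1 z); apply: subset_leq_card; exact/subsetP.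
Qed.

Definition pcyc (cs : seq (seq T)) : {perm T} := \prod_(s <- cs) cyc s.

Lemma pcyc_out cs z : z \notin flatten cs -> pcyc cs z = z.
Proof.
rewrite /pcyc; elim: cs => [|s cs IH]; first by rewrite big_nil perm1.
rewrite /= mem_cat negb_or big_cons permM => /andP[zs zcs].
by rewrite cyc_out ?IH.
Qed.

Lemma pcycE cs s z : uniq (flatten cs) -> s \in cs -> z \in s -> pcyc cs z = cyc s z.
Proof.
rewrite /pcyc; elim: cs => [|t cs IH] //=.
rewrite cat_uniq big_cons permM => /and3P[ut /hasPn tcs ucs].
rewrite inE => /orP[/eqP -> zt|scs zs].
  by rewrite -/(pcyc cs) pcyc_out //; apply: contraL (cyc_in zt) => /tcs.
rewrite (@cyc_out _ t) ?IH //; apply: tcs.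
by apply/flattenP; exists s.
Qed.

Lemma pcycX cs s z e : uniq (flatten cs) -> s \in cs -> z \in s ->
  (pcyc cs ^+ e) z = (cyc s ^+ e) z.
Proof.
move=> ucs scs zs; rewrite !permX.
suff: (iter e (pcyc cs) z == iter e (cyc s) z) && (iter e (cyc s) z \in s).
  by case/andP => /eqP.
elim: e => [|e] /=; first by rewrite eqxx.
by case/andP=> /eqP -> ?; rewrite (pcycE ucs scs) // eqxx cyc_in.
Qed.

Lemma odd_pcyc cs : all uniq cs ->
  odd_perm (pcyc cs) = odd (\sum_(s <- cs) (size s).-1).
Proof.
rewrite /pcyc; elim: cs => [|s cs IH]; first by rewrite !big_nil odd_perm1.
by case/andP=> us ucs; rewrite !big_cons odd_permM oddD odd_cyc // IH.
Qed.

Lemma sqr_double_mod3 m : ~~ (3 %| m) -> ((m * 2) ^ 2 %% 3 = 1)%N.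
Proof.
move=> m3; have : (m * 2 %% 3 = 1 \/ m * 2 %% 3 = 2)%N by lia.
by rewrite -modnXm => -[] ->.
Qed.

(** The spider is the product of [(a b c)], the transpositions in [P] and one cycle on the list [R]
    of remaining points. The size bound gives [R] at least two points, and the divisibility
    condition makes its length prime to 3. *)
Lemma spider_exists a b c (P : seq (seq T)) :
  uniq (a :: b :: c :: flatten P) -> {in P, forall s, size s = 2} ->
  (size P).*2 + 4 < #|T| -> ~~ (3 %| #|T| - (size P).*2) ->
  exists x, spider a [set z in b :: c :: flatten P] x /\
            odd_perm x = odd (#|T| + size P).
Proof.
move=> uP P2 ltT ndvd.
pose L := a :: b :: c :: flatten P; pose R := [seq z <- enum T | z \notin L].
pose cs := [:: [:: a; b; c], R & P].
have szP : size (flatten P) = (size P).*2.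
  rewrite size_flatten -muln2 mulnC /shape.
  elim: P P2 {uP ltT ndvd L R cs} => [|s P IH] P2 //=.
  by rewrite P2 ?mem_head // IH ?mulnS // => t tP; rewrite P2 // inE tP orbT.
have pcs : perm_eq (flatten cs) (L ++ R).
  by rewrite /= !perm_cons perm_catC.
have uR : uniq R by rewrite filter_uniq // enum_uniq.
have uLR : uniq (L ++ R).
  rewrite cat_uniq uP uR andbT; apply/hasPn => z.
  by rewrite mem_filter => /andP[].
have ucs : uniq (flatten cs) by rewrite (perm_uniq pcs).
have memcs z : z \in flatten cs.
  by rewrite (perm_mem pcs) mem_cat mem_filter mem_enum andbT orbN.
have szR : size R = #|T| - 3 - (size P).*2.
  have : size (L ++ R) = #|T|.
    rewrite -(card_uniqP uLR) -cardsT -cardsE; apply: eq_card => z.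
    by rewrite in_set in_setT -(perm_mem pcs) memcs.
  rewrite size_cat /= szP; lia.
have Rcs : R \in cs by rewrite !inE eqxx orbT.
have allu s : s \in cs -> uniq s.
  move=> scs; move: ucs; clear -scs; elim: cs scs => //= t cs IH.
  by rewrite inE cat_uniq => /orP[/eqP -> /andP[]//|/IH h /and3P[_ _ /h]].
have cs1 s : s \in cs -> 1 < size s.
  by rewrite !inE => /or3P[/eqP -> //|/eqP ->|/P2 ->] //; rewrite szR; lia.
have cyE s z : s \in cs -> z \in s -> pcyc cs z = cyc s z by exact: pcycE.
have EE : a |: [set z in b :: c :: flatten P] = ~: [set z in R].
  apply/setP => z; by rewrite !inE mem_filter mem_enum andbT negbK !inE.
exists (pcyc cs); split; last first.
  rewrite odd_pcyc; last by apply/allP.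
  rewrite !big_cons /= szR.
  have -> : \sum_(s <- P) (size s).-1 = size P.
    rewrite -sum1_size !big_seq; apply: eq_bigr => s /P2 -> //.
  set m := _.-1; have -> : #|T| = m + (size P).+2.*2 by rewrite /m; lia.
  by rewrite negbK add0n !oddD odd_double addbF.
have stR : {in [set z in R], forall z, pcyc cs z \in [set z in R]}.
  by move=> z; rewrite !inE => zR; rewrite (cyE R) // cyc_in.
have u3 : uniq [:: a; b; c].
  by move: uP; rewrite -[a :: _]/([:: a; b; c] ++ _) cat_uniq => /andP[].
have abc_cs : [:: a; b; c] \in cs by rewrite mem_head.
have xE z : z \in [:: a; b; c] -> pcyc cs z = tri a b c z.
  by move=> zs; rewrite (cyE _ _ abc_cs zs) /= !big_cons big_nil mulg1.
have [ta tb tc] := triE u3.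
have xa : pcyc cs a = b by rewrite xE ?mem_head.
have xb : pcyc cs b = c by rewrite xE ?inE ?eqxx ?orbT.
split.
- by move: uP; rewrite inE /= => /andP[].
- by rewrite EE; apply: stable_setC.
- move=> z; have /flattenP[s scs zs] := memcs z.
  by rewrite (cyE s) // cyc_fixfree ?allu ?cs1.
- move=> K z stK; rewrite EE setCK inE negbK inE => zR zK.
  apply/subsetP => w; rewrite inE.
  apply: (cyc_trans uR _ zR zK) => v vR vK.
  by rewrite -(cyE R) // stK.
(* The exponent is divisible by the lengths 2 and [size R] of the other cycles
   and congruent to 1 modulo 3. *)
exists ((size R * 2) ^ 2)%N; rewrite xa xb; split=> //.
apply/permP => z; have /flattenP[s scs zs] := memcs z.
rewrite (pcycX _ ucs scs zs).
have cyc3 : tri a b c = cyc [:: a; b; c] by rewrite /= !big_cons big_nil mulg1.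
move: (scs); rewrite inE => /orP[/eqP es|sRP].
  have R3 : ~~ (3 %| size R).
    by rewrite szR -subnDA addnC subnDA dvdn_subl //; lia.
  rewrite es -(@expg_mod _ 3) ?(cyc_exp u3) //.
  by rewrite sqr_double_mod3 // expg1 cyc3.
have zabc : z \notin [:: a; b; c].
  have : uniq ([:: a; b; c] ++ flatten (R :: P)) by [].
  rewrite cat_uniq => /and3P[_ /hasPn h _].
  by apply: h; apply/flattenP; exists s.
rewrite cyc3 (cyc_out zabc).
have [k ->] : exists k, ((size R * 2) ^ 2 = size s * k)%N.
  move: sRP; rewrite inE => /orP[/eqP ->|/P2 ->].
    by exists (size R * 4)%N; rewrite -mulnn mulnACA -mulnA.
  by exists (size R * size R * 2)%N; rewrite -mulnn mulnACA mulnA mulnC.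
by rewrite expgM cyc_exp ?allu // expg1n perm1.
Qed.

End Spiders.

(** * Choice of the parity and of the bodies *)

(** One of 0 and 1 gives the right parity; if 3 then divides [N - k.*2], adding 2 to [k] keeps the
    parity and lowers this number by 4. *)
Lemma spider_param N (eps : bool) : 9 < N ->
  exists k, [/\ k <= 3, odd (N + k) = eps & ~~ (3 %| N - k.*2)].
Proof.
move=> N9; pose k0 : nat := odd N (+) eps.
have ko : odd (N + k0) = eps by rewrite oddD oddb addKb.
have k1 : k0 <= 1 by rewrite /k0; case: (_ (+) _).
have [h|h] := boolP (3 %| N - k0.*2).
  by exists k0.+2; split; [lia|rewrite !addnS /= negbK|lia].
by exists k0; split=> //; lia.
Qed.

(** Eight marks: two for the 3-cycle and six for at most three 2-cycles. *)
Definition ruler := [:: 0; 1; 4; 9; 15; 22; 32; 34]%N.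

(** The Golomb property, with [d1 - d2 = d3 - d4] written as sums to avoid truncated subtraction. *)
Lemma ruler_sidon d1 d2 d3 d4 : d1 \in ruler -> d2 \in ruler -> d3 \in ruler ->
  d4 \in ruler -> (d1 + d4 = d2 + d3)%N -> d1 != d2 -> d1 = d3.
Proof.
have : all (fun d1 => all (fun d2 => all (fun d3 => all (fun d4 =>
  [|| d1 + d4 != d2 + d3, d1 == d2 | d1 == d3]%N) ruler) ruler) ruler) ruler by vm_compute.
move=> /allP h /h /allP{}h /h /allP{}h /h /allP{}h /h + e ne.
by rewrite e eqxx (negPf ne) => /eqP.
Qed.

Lemma spider_family n (eps : bool) (a := @ord_max n) : 50 <= n ->
  exists (x : 'I_(n - 40) -> {perm 'I_n.+1}) (E : 'I_(n - 40) -> {set 'I_n.+1}),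
    [/\ forall i, spider a (E i) (x i), forall i, odd_perm (x i) = eps &
       forall i j, i != j -> #|E i :&: E j| <= 1].
Proof.
move=> n50; have [k [k3 ok nk]] := @spider_param n.+1 eps ltac:(lia).
(* For marks [d <= 34] and [i < n - 40] the sum stays below [n], so [inord] never takes its default
   value and the body avoids [a], which is [n]. *)
pose f i d : 'I_n.+1 := inord (i + d).
pose Q := take k [:: [:: 4; 9]; [:: 15; 22]; [:: 32; 34]]%N.
have subQ : {subset 0 :: 1 :: flatten Q <= ruler}%N.
  by apply/allP; rewrite /Q; move: k k3 {ok nk Q}; do 4?[case=> //].
have uQ : uniq (0 :: 1 :: flatten Q)%N.
  by rewrite /Q; move: k k3 {ok nk Q subQ}; do 4?[case=> //].
have fE (i : 'I_(n - 40)) d : d \in ruler -> i + d < n /\ f i d = i + d :> nat.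
  move=> dr; have d34 : d <= 34 by move: d dr; apply/allP.
  have lt : i + d < n by have := ltn_ord i; lia.
  by split=> //; rewrite inordK // ltnW.
pose E (i : 'I_(n - 40)) := [set z in map (f i) (0 :: 1 :: flatten Q)%N].
suff /fin_all_exists[x xP] : forall i, exists x, spider a (E i) x /\ odd_perm x = eps.
  exists x, E; split=> [i|i|i j ij]; try by case: (xP i).
  (* Two common points are [u = i + d1 = j + d2] and [v = i + d3 = j + d4], whence
     [d1 + d4 = d2 + d3]. *)
  apply/card_le1_eqP => u v; rewrite !in_setI !in_set => /andP[].
  move=> /mapP[d1 /subQ r1 u1] /mapP[d2 /subQ r2 u2].
  move=> /andP[/mapP[d3 /subQ r3 v3] /mapP[d4 /subQ r4 v4]].
  have [_ e1] := fE i _ r1; have [_ e2] := fE j _ r2.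
  have [_ e3] := fE i _ r3; have [_ e4] := fE j _ r4.
  rewrite -u1 in e1; rewrite -u2 in e2; rewrite -v3 in e3; rewrite -v4 in e4.
  have d12 : d1 != d2.
    by apply: contraNneq ij => d12; apply/eqP/val_inj => /=; lia.
  by rewrite u1 v3 (ruler_sidon r1 r2 r3 r4) //; lia.
move=> i; rewrite -ok.
have szQ : size Q = k by rewrite size_take /=; case: ltngtP k3; lia.
have := @spider_exists _ a (f i 0) (f i 1) (map (map (f i)) Q).
rewrite -map_flatten size_map szQ card_ord; apply; rewrite ?nk //; last lia.
  rewrite -[f i 0 :: _]/(map (f i) (0 :: 1 :: flatten Q))%N cons_uniq.
  apply/andP; split.
    apply/mapP => -[d /subQ dr ed].
    by have [lt e] := fE i _ dr; move: lt; rewrite -e -ed ltnn.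
  rewrite map_inj_in_uniq // => d d' /subQ dr /subQ dr' e.
  have [_ e1] := fE i _ dr; have [_ e2] := fE i _ dr'.
  by rewrite e in e1; lia.
move=> s /mapP[t tQ ->]; rewrite size_map.
by move/mem_take: tQ; rewrite !inE => /or3P[] /eqP ->.
Qed.

(** * Lower bounds for [omega] *)

(** Handles both groups at once: [eps] is the parity of the spiders, true for the symmetric group
    and false for the alternating group. *)
Lemma omega_ge n (eps : bool) (G : {group {perm 'I_n.+1}}) : 50 <= n ->
  (forall x, odd_perm x = eps -> x \in G) ->
  (forall x (H : {group {perm 'I_n.+1}}), x \in H -> odd_perm x = eps ->
     ('Alt_('I_n.+1))%g \subset H -> G \subset H) ->
  n - 40 <= omega G.
Proof.
move=> n50 inG genG; have [x [E [sp ox le1]]] := spider_family eps n50.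
have injx : injective x.
  move=> i j exy; apply/eqP/negPn/negP => ij.
  by move: (spider_neq (sp i) (sp j) (le1 _ _ ij)); rewrite exy eqxx.
rewrite -{1}(card_ord (n - 40)) -(card_codom injx) -cardsE.
rewrite /omega; apply: (@leq_bigmax_cond _ _ (fun S : {set _} => #|S|) [set y in codom x]).
apply/andP; split.
  by apply/subsetP => y; rewrite inE => /codomP[i ->]; apply: inG.
apply/forall_inP => y; rewrite inE => /codomP[i ->].
apply/forall_inP => z; rewrite inE => /codomP[j ->]; apply/implyP => xij.
have ij : i != j by apply: contraNneq xij => ->.
rewrite eqEsubset; apply/andP; split.
  by rewrite gen_subG; apply/subsetP => y0; rewrite !inE => /orP[]/eqP ->; apply: inG.
apply: (genG (x i) <<_>>%G _ (ox i)); first by rewrite mem_gen // !inE eqxx.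
exact: spider_gen (sp i) (sp j) (le1 _ _ ij).
Qed.

Lemma omega_Sym n : 50 <= n -> n - 40 <= omega ('Sym_('I_n.+1))%g.
Proof.
move=> n50; apply: (@omega_ge n true) => // [x|x H xH ox altH]; first by rewrite inE.
apply/subsetP => y _; have [oy|oy] := boolP (odd_perm y); last first.
  by apply: (subsetP altH); rewrite Alt_even.
rewrite -(mulgKV x y) groupM //; apply: (subsetP altH).
by rewrite Alt_even odd_permM odd_permV oy ox.
Qed.

Lemma omega_Alt n : 50 <= n -> n - 40 <= omega ('Alt_('I_n.+1))%g.
Proof.
move=> n50; apply: (@omega_ge n false) => // x; first by rewrite Alt_even => ->.
Qed.

Local Open Scope ring_scope.

Theorem proposition1 (R : realType) :
  forall delta : R, 0 < delta ->
  exists n0 : nat, forall n : nat, (n0 <= n)%N ->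
    (1 - delta) * n%:R <= (omega ('Sym_('I_n))%g)%:R /\
    (1 - delta) * n%:R <= (omega ('Alt_('I_n))%g)%:R.
Proof.
(* In degree [n.+1] the bound [n - 40] falls short of the degree by 41, which [delta * n.+1] must
   absorb; 51 ensures [50 <= n]. *)
move=> delta d0; exists (maxn 51 (Num.bound (41 / delta))) => -[|n].
  by rewrite geq_max.
rewrite geq_max => /andP[n50 nb].
have lt : 41 <= delta * n.+1%:R.
  rewrite mulrC -ler_pdivrMr //; apply: le_trans (ltW (archi_boundP _)) _.
    by rewrite divr_ge0 // ltW.
  by rewrite ler_nat.
have le : (1 - delta) * n.+1%:R <= (n - 40)%N%:R.
  rewrite natrB; last by lia.
  by rewrite mulrBl mul1r -natr1; lra.
have n50' : (50 <= n)%N by [].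
split; apply: (le_trans le); rewrite ler_nat.
  exact: omega_Sym n50'.
exact: omega_Alt n50'.
Qed.
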